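(* Let $G$ be a connected graph (finite or infinite) and let $G'$ be a connected graph on the same vertex set constructed from $G$ by changing (adding or removing) finitely many edges. Then the metric dimension of $G$ is finite if and only if the metric dimension of $G'$ is finite.
   Context: Graphs are simple. For a connected graph $G$, $d_G(u,v)$ is the number of edges of a shortest $u$--$v$ path. A vertex $w$ resolves $u,v$ if $d_G(u,w)\ne d_G(v,w)$; a set $W\subseteq V(G)$ is a resolving set if every two distinct vertices of $G$ are resolved by some $w\in W$. The metric dimension $\beta(G)$ is the minimum cardinality of a resolving set; it is finite iff a finite resolving set exists. *)

(* Defs.v *)
From mathcomp Require Import all_boot.
From mathcomp Require Import boolp classical_sets functions cardinality.

Set Implicit Arguments.
Unset Strict Implicit.
Unset Printing Implicit Defensive.

Local Open Scope classical_set_scope.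
Local Open Scope card_scope.

Record graph (V : Type) := Graph {
  adj :> rel V;
  adj_sym : symmetric adj;
  adj_irr : irreflexive adj
}.

Section MetricDimension.
Variables (V : Type) (G : graph V).
Implicit Types (u v w : V) (p : seq V) (W : set V).

Definition edges : set (set V) :=
  [set e | exists u v, adj G u v /\ e = [set u; v]].

(* The path has vertices u :: p, hence size p edges. *)
Definition is_path u v p : Prop :=
  [/\ path (adj G) u p, last u p = v & uniq (u :: p : seq {classic V})].

Definition connected : Prop := forall u v, exists p, is_path u v p.

Definition is_dist u v (n : nat) : Prop :=
  (exists2 p, is_path u v p & size p = n) /\
  (forall p, is_path u v p -> (n <= size p)%N).

(* Only meaningful for connected G: the value is 0 when no path exists. *)
Definition dist u v : nat := xget 0%N [set n | is_dist u v n].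

Definition resolves w u v : Prop := dist u w <> dist v w.

Definition resolving_set W : Prop :=
  forall u v, u <> v -> exists2 w, W w & resolves w u v.

Definition metric_dimension_is (n : nat) : Prop :=
  (exists2 W, resolving_set W & W #= `I_n) /\
  (forall W, resolving_set W -> `I_n #<= W).

Definition finite_metric_dimension : Prop := exists n, metric_dimension_is n.

End MetricDimension.

(* Main.v *)
Require Import Defs.
From mathcomp Require Import all_boot.
From mathcomp Require Import boolp classical_sets functions cardinality.
From mathcomp Require Import zify.

Set Implicit Arguments.
Unset Strict Implicit.
Unset Printing Implicit Defensive.

Local Open Scope classical_set_scope.

(**
  Let S be the finite set of endpoints of changed edges and W a finite resolving
  set of G.  Cutting a geodesic of one graph at its last visit to S leaves a
  walk of the other graph, so distances from S change by a bounded amount.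
  A finite metric dimension forces balls to be finite, so adding to S a large
  ball B around W yields a finite set.  It resolves G': if w in W has
  d(u,w) < d(v,w), replace w by the point x at a large fixed distance R from w
  on a geodesic to u, or by u itself if u is in B.  No geodesic from x to u
  meets S, so d'(u,x) <= d(u,x) < d(v,x); and either d(v,x) <= d'(v,x) or a
  geodesic of G' from v to x meets S, in which case it is too long unless
  a point of S already resolves u and v.
*)

Section Distance.
Variables (V : Type) (G : graph V).
Hypothesis Gconn : connected G.
Implicit Types (u v w : V) (p : seq V).

Lemma is_distP u v : is_dist G u v (dist G u v).
Proof.
apply: xgetPex; have [p0 Pp0] := Gconn u v.
have exn : exists n, `[< exists2 p, is_path G u v p & size p = n >].
  by exists (size p0); apply/asboolP; exists p0.
case: (ex_minnP exn) => n /asboolP Pn minn; exists n; split=> // p Pp.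
by apply: minn; apply/asboolP; exists p.
Qed.

(** [is_dist] minimises over simple paths only, so the walk is first shortened to one. *)
Lemma dist_le_walk u p : path (adj G) u p -> (dist G u (last u p) <= size p)%N.
Proof.
move=> Gp; have [_ dmin] := is_distP u (last u p).
case: (@shortenP {classic V} _ u p Gp) dmin => q Gq Uq sub_qp dmin.
apply: leq_trans (dmin q _) _; first by split.
by apply: (@uniq_leq_size {classic V}) sub_qp; case/andP: Uq.
Qed.

Lemma dist_walk u v :
  exists p, [/\ path (adj G) u p, last u p = v & size p = dist G u v].
Proof. by have [[p [Gp pv _] sz_p] _] := is_distP u v; exists p. Qed.

Lemma distxx u : dist G u u = 0%N.
Proof. by have := @dist_le_walk u [::] isT; rewrite leqn0 => /eqP. Qed.

Lemma dist_eq0 u v : dist G u v = 0%N -> u = v.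
Proof. by have [[|x p] [_ <- <-]] := dist_walk u v. Qed.

Lemma dist_le_sym u v : (dist G v u <= dist G u v)%N.
Proof.
have [p [Gp <- <-]] := dist_walk u v.
have := @dist_le_walk (last u p) (rev (belast u p)).
rewrite rev_path size_rev size_belast (eq_path (e' := adj G)); last first.
  by move=> x y; rewrite adj_sym.
have -> : last (last u p) (rev (belast u p)) = u.
  by case: (p) => //= x q; rewrite rev_cons last_rcons.
exact.
Qed.

Lemma dist_sym u v : dist G u v = dist G v u.
Proof. by apply/eqP; rewrite eqn_leq !dist_le_sym. Qed.

Lemma dist_triangle u v w : (dist G u w <= dist G u v + dist G v w)%N.
Proof.
have [p [Gp pv <-]] := dist_walk u v; have [q [Gq qw <-]] := dist_walk v w.
rewrite -size_cat -qw -pv -last_cat; apply: dist_le_walk.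
by rewrite cat_path Gp pv.
Qed.

(** Take the [n]-th vertex of a geodesic: its two pieces bound the distances above, and the triangle
    inequality forces equality. *)
Lemma dist_split u v n : (n <= dist G u v)%N ->
  exists x, dist G u x = n /\ (dist G u v = n + dist G x v)%N.
Proof.
have [p [Gp pv sz_p]] := dist_walk u v => le_n.
exists (last u (take n p)).
have := Gp; rewrite -{1}[p](cat_take_drop n) cat_path => /andP[Gt Gd].
have := dist_le_walk Gt; have := dist_le_walk Gd.
rewrite -last_cat cat_take_drop pv size_take_min size_drop.
have := dist_triangle u (last u (take n p)) v.
lia.
Qed.

(** A vertex is determined by its vector of distances to [W], and only finitely many vectors have
    all entries at most [M]. *)
Lemma finite_dist_le (W : set V) M : finite_set W -> resolving_set G W ->
  finite_set [set y | forall w, W w -> (dist G y w <= M)%N].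
Proof.
move=> /(@finite_seqP {classic V})[s Ws] resW; set B := [set y | _].
pose f y : (size s).-tuple 'I_M.+1 :=
  map_tuple (fun w => inord (dist G y w)) (in_tuple s).
have injf : {in B &, injective f}.
  move=> u v /set_mem Bu /set_mem Bv fuv; apply: contrapT => /resW[w Ww]; apply.
  have /(@eq_in_map {classic V})/(_ w) : map (fun w => inord (dist G u w) : 'I_M.+1) s =
                          map (fun w => inord (dist G v w)) s.
    by have := congr1 val fuv.
  have ws : (w : {classic V}) \in s by have := Ww; rewrite Ws.
  by move=> /(_ ws)/(congr1 val); rewrite /= !inordK ?ltnS //; [apply: Bv|apply: Bu].
by rewrite -(eq_finite_set (inj_card_eq injf)); apply: finite_finset.
Qed.

End Distance.

Lemma finite_set_bounded (T : Type) (A : set T) (f : T -> nat) :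
  finite_set A -> exists K, forall a, A a -> (f a <= K)%N.
Proof.
move=> /(finite_image f)/finite_seqP[s fAs].
exists (\max_(n <- s) n)%N => a Aa.
apply: (@leq_bigmax_seq _ s xpredT id (f a)) => //.
by have : (f @` A) (f a) by [exists a]; rewrite fAs.
Qed.

Lemma finite_metric_dimensionP (V : Type) (G : graph V) :
  finite_metric_dimension G <-> exists2 W, finite_set W & resolving_set G W.
Proof.
split=> [[n [[W resW Wn] _]]|[W0 finW0 resW0]].
  by exists W => //; apply/finite_setP; exists n.
have exn : exists n, `[< exists2 W, resolving_set G W & (W #= `I_n)%card >].
  by move/finite_setP: finW0 => [n Wn]; exists n; apply/asboolP; exists W0.
case: (ex_minnP exn) => n /asboolP Pn minn; exists n; split=> // W resW.
have [/finite_setP[m Wm]|infW] := pselect (finite_set W).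
  rewrite (card_le_eqr Wm) card_le_II; apply: minn.
  by apply/asboolP; exists W.
(* An infinite resolving set dominates every [I_n] through the naturals. *)
by apply: card_le_trans (card_leT _) _; apply/infiniteP.
Qed.

Section EdgeChange.
Variables (V : Type) (S : set V).

(** One-sided: it controls the edges lost from [G] to [G'], which are what can break a walk of [G].
    Swapping the graphs controls the added edges. *)
Definition eq_adj_off (G G' : graph V) :=
  forall u v, adj G u v -> ~~ adj G' u v -> S u /\ S v.

Variables G G' : graph V.
Hypotheses (Gconn : connected G) (G'conn : connected G').
Hypothesis GG' : eq_adj_off G G'.

(** The cut is made just after the last edge of the walk that is missing in [G']; the far end of
    that edge lies in [S]. *)
Lemma walk_last_visit u p : path (adj G) u p ->
  path (adj G') u p \/
  exists p1 p2, [/\ p = p1 ++ p2, S (last u p1) & path (adj G') (last u p1) p2].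
Proof.
elim: p u => [|x p IHp] u /=; first by left.
case/andP=> Gux /IHp[G'p|[p1 [p2 [-> Ss G'p2]]]]; last first.
  by right; exists (x :: p1), p2.
have [G'ux|/(GG' Gux)[_ Sx]] := boolP (adj G' u x); first by left.
by right; exists [:: x], p.
Qed.

Lemma dist_last_visit u v : (dist G' u v <= dist G u v)%N \/
  exists2 s, S s & (dist G' s v <= dist G s v)%N /\ (dist G s v <= dist G u v)%N.
Proof.
have [p [Gp <- sz_p]] := dist_walk Gconn u v; rewrite -sz_p.
have [G'p|[p1 [p2 [def_p Ss G'p2]]]] := walk_last_visit Gp.
  by left; apply: dist_le_walk.
right; exists (last u p1) => //.
have := sz_p; rewrite def_p last_cat size_cat => sz.
have := Gp; rewrite def_p cat_path => /andP[Gp1 Gp2].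
have := dist_le_walk Gconn Gp1; have := dist_le_walk Gconn Gp2.
have := dist_le_walk G'conn G'p2.
(* The tail of a geodesic is a geodesic, so [size p2] is the [G]-distance from the cut point to the
   end. *)
have := dist_triangle Gconn u (last u p1) (last (last u p1) p2).
lia.
Qed.

(** Reach the cut point [s] from [t] at cost [K]; from [s] on, [G'] is no slower than [G]. *)
Lemma dist_bounded_change K :
    (forall s t, S s -> S t -> (dist G' s t <= K)%N) ->
  forall t v, S t -> (dist G' t v <= K + dist G t v)%N.
Proof.
move=> leK t v St; have [|[s Ss]] := dist_last_visit t v; first by lia.
have := dist_triangle G'conn t s v; have := leK t s St Ss; lia.
Qed.

End EdgeChange.

Lemma finite_resolving_transfer (V : Type) (S : set V) (G G' : graph V) :
    finite_set S -> connected G -> connected G' ->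
    eq_adj_off S G G' -> eq_adj_off S G' G ->
    (exists2 W, finite_set W & resolving_set G W) ->
  exists2 W, finite_set W & resolving_set G' W.
Proof.
move=> finS cG cG' GG' G'G [W finW resW].
have finT : finite_set (W `|` S) by rewrite finite_setU.
have [K leK] := finite_set_bounded (fun a => dist G a.1 a.2) (finite_setX finT finT).
have {}leK a b : (W `|` S) a -> (W `|` S) b -> (dist G a b <= K)%N.
  by move=> Ta Tb; apply: (leK (a, b)).
have changeK t v : S t -> (dist G t v <= K + dist G' t v)%N.
  by apply: (dist_bounded_change cG' cG G'G) => s s' Ss Ss'; apply: leK; right.
(* The final contradiction is [R <= K + K]: one [K] comes from [farS], the other from [changeK]. *)
pose R := (K + K).+1.
(* The extra [K] lets a point within [R] of one vertex of [W] meet the bound for all of them. *)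
pose B := [set y | forall w, W w -> (dist G y w <= K + R)%N].
exists (S `|` B); first by rewrite finite_setU; split=> //; apply: finite_dist_le.
have B_near w y : W w -> (dist G w y <= R)%N -> B y.
  move=> Ww le_wy w' Ww'; have := dist_triangle cG y w w'.
  by have := leK w w' (or_introl Ww) (or_introl Ww'); rewrite (dist_sym cG y w); lia.
suff lt_case u v w : u <> v -> W w -> (dist G u w < dist G v w)%N ->
    exists2 x, (S `|` B) x & resolves G' x u v.
  move=> u v uv; have [w Ww] := resW u v uv; rewrite /resolves => /eqP.
  rewrite neq_ltn => /orP[lt_uv|lt_vu]; first exact: lt_case lt_uv.
  have vu : v <> u by move=> /esym.
  by have [x Xx res_x] := lt_case v u w vu Ww lt_vu; exists x => // /esym.
move=> uv Ww lt_uv.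
have [le_uR|lt_Ru] := leqP (dist G w u) R.
  exists u; first by right; apply: B_near le_uR.
  by rewrite /resolves distxx // => /esym/(dist_eq0 cG')/esym.
have [x [wx wu]] := dist_split cG (ltnW lt_Ru).
have [[s Ss res_s]|noS] := pselect (exists2 s, S s & resolves G' s u v).
  by exists s => //; left.
have {noS}eqS s : S s -> dist G' s u = dist G' s v.
  move=> Ss; apply: contrapT => neq_s; apply: noS; exists s => //.
  by rewrite /resolves !(dist_sym cG' _ s).
(* [u] lies at distance [R + dist G x u] from [w], and [s] is within [K] of [w]. *)
have farS s : S s -> (R + dist G x u <= K + dist G s u)%N.
  move=> Ss; rewrite -wu; have := dist_triangle cG w s u.
  by have := leK w s (or_introl Ww) (or_intror Ss); lia.
exists x; first by right; apply: (B_near w) => //; rewrite wx.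
rewrite /resolves !(dist_sym cG' _ x) => eq_x.
have lt_x : (dist G x u < dist G x v)%N.
  by have := dist_triangle cG w x v; move: lt_uv; rewrite !(dist_sym cG _ w); lia.
have le_xu : (dist G' x u <= dist G x u)%N.
  have [//|[s Ss [_]]] := dist_last_visit cG cG' GG' x u.
  by have := farS s Ss; rewrite /R; lia.
(* Without a cut point, [dist G x v <= dist G' x v] contradicts [eq_x], [le_xu] and [lt_x]. *)
have [|[s Ss [_]]] := dist_last_visit cG' cG G'G x v; first by lia.
have := farS s Ss; have := changeK s u Ss; have := eqS s Ss; rewrite /R; lia.
Qed.

Lemma edges_set2 (V : Type) (G : graph V) u v : edges G [set u; v] <-> adj G u v.
Proof.
split=> [[x [y [Gxy uv_xy]]]|Guv]; last by exists u, v.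
have [ux|uy] : [set x; y] u by rewrite -uv_xy; left.
  (* The case [y = u] would make the edge a loop. *)
  have [|vy] : [set u; v] y by rewrite uv_xy; right.
    by rewrite ux => yx; move: Gxy; rewrite yx adj_irr.
  by rewrite ux -vy.
have [|vx] : [set u; v] x by rewrite uv_xy; left.
  by rewrite uy => xy; move: Gxy; rewrite xy adj_irr.
by rewrite uy -vx adj_sym.
Qed.

Definition changed_ends (V : Type) (G G' : graph V) : set V :=
  \bigcup_(e in edges G `+` edges G') e.

Lemma finite_changed_ends (V : Type) (G G' : graph V) :
  finite_set (edges G `+` edges G') -> finite_set (changed_ends G G').
Proof.
move=> fin; apply: bigcup_finite => // e [[[u [v [_ ->]]] _]|[[u [v [_ ->]]] _]];
  exact: finite_set2.
Qed.

Lemma eq_adj_off_changed_ends (V : Type) (G G' : graph V) :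
  eq_adj_off (changed_ends G G') G G'.
Proof.
move=> u v /edges_set2 Guv G'uv.
have ch : (edges G `+` edges G') [set u; v].
  by left; split=> // /edges_set2; apply/negP.
by split; exists [set u; v] => //; [left|right].
Qed.

Theorem corollary3p3 (V : Type) (G G' : graph V)
  (hG : connected G) (hG' : connected G')
  (hGG' : finite_set (edges G `+` edges G')) :
  finite_metric_dimension G <-> finite_metric_dimension G'.
Proof.
have finS := finite_changed_ends hGG'.
have GG' := @eq_adj_off_changed_ends V G G'.
have G'G : eq_adj_off (changed_ends G G') G' G.
  by rewrite /changed_ends setYC; apply: eq_adj_off_changed_ends.
by rewrite !finite_metric_dimensionP; split;
  [apply: finite_resolving_transfer GG' G'G|apply: finite_resolving_transfer G'G GG'].
Qed.
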